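(* Let $G$ be a singleton-partition graph of order $n$ with $\delta(G)=1$ that contains a full vertex. Then: (a) If $n=2$, then $G=K_2$, $L_{\rm SCC}(G)=\infty$, and the $G$-SC chain is $K_2\to\overline{K}_2\to K_2\to\overline{K}_2\to\cdots$. (b) If $n>3$ and $L_{\rm SCC}(G)=1$, then the $G$-SC chain is $G\to K_1\cup K_{1,n-2}$. (c) If $n=3$, then $G=P_3$, $L_{\rm SCC}(G)=\infty$, and the $G$-SC chain is $P_3\to K_1\cup K_2\to P_3\to K_1\cup K_2\to\cdots$.
   Context: All graphs are finite and simple. A full vertex is a vertex adjacent to all other vertices. A set $D\subseteq V$ is dominating if every vertex not in $D$ has a neighbor in $D$. Two disjoint sets $A,B\subseteq V$ form a coalition if neither is dominating but $A\cup B$ is. A coalition partition of $G$ is a partition $\mathcal{P}$ of $V$ such that every member is either a dominating set of cardinality 1, or is not dominating and forms a coalition with some other member. The coalition graph ${\rm CG}(G,\mathcal{P})$ has vertex set $\mathcal{P}$, two members adjacent iff they form a coalition. $\Gamma_1$ is the partition of $V$ into singletons; $G$ is a singleton-partition graph (SP-graph) if $\Gamma_1$ is a coalition partition of $G$. A singleton coalition graph chain with initial graph $G_1$ is a sequence $G_1\to G_2\to\cdots$ where each graph having a successor is an SP-graph and its successor is ${\rm CG}(G_i,\Gamma_1)$ (up to isomorphism). The $G$-SC chain is such a chain starting at $G$ of maximum possible length (it continues as long as the current graph is an SP-graph; it is infinite if this never fails). Its length $L_{\rm SCC}(G)$ is $k-1$ for a chain $G_1\to\cdots\to G_k$ and $\infty$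 for an infinite chain, with the convention that if all graphs in the chain are isomorphic the length is $0$. $\overline{K}_m$ is the edgeless graph on $m$ vertices, $\cup$ is disjoint union. *)

(* Defs.v *)
From Stdlib Require List.
From mathcomp Require Import all_boot.
From mathcomp Require Import boolp.

Set Implicit Arguments.
Unset Strict Implicit.
Unset Printing Implicit Defensive.

Record sgraph := SGraph {
  vertex :> finType;
  adj : rel vertex;
  adj_sym : symmetric adj;
  adj_irrefl : irreflexive adj }.

Arguments adj {s} x y.

Definition giso (G H : sgraph) : Prop :=
  exists f : G -> H, bijective f /\ forall x y : G, adj (f x) (f y) = adj x y.

Definition degree (G : sgraph) (v : G) : nat := #|[set w | adj v w]|.

(* Degrees never exceed #|G|, so the neutral value #|G| does not affect the
   minimum; the null graph gets minimum degree 0. *)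
Definition min_degree (G : sgraph) : nat :=
  \big[minn/#|G|]_(v : G) degree v.

Definition full_vertex (G : sgraph) (v : G) : bool :=
  [forall w, (w != v) ==> adj v w].

Definition dominating (G : sgraph) (D : {set G}) : bool :=
  [forall v, (v \notin D) ==> [exists w in D, adj v w]].

Definition coalition (G : sgraph) (A B : {set G}) : bool :=
  [&& [disjoint A & B], ~~ dominating A, ~~ dominating B
    & dominating (A :|: B)].

Definition coalition_partition (G : sgraph) (P : {set {set G}}) : bool :=
  partition P [set: G] &&
  [forall A in P,
     (dominating A && (#|A| == 1)) ||
     (~~ dominating A && [exists B in P, (B != A) && coalition A B])].

Lemma coalition_sym (G : sgraph) : symmetric (@coalition G).
Proof.
by move=> A B; rewrite /coalition disjoint_sym setUC; congr (_ && _); rewrite andbCA.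
Qed.

Lemma coalition_irrefl (G : sgraph) : irreflexive (@coalition G).
Proof. by move=> A; rewrite /coalition setUid; case: (dominating A); rewrite /= ?andbF. Qed.

Definition CG_vertex (G : sgraph) (P : {set {set G}}) : finType :=
  {A : {set G} | A \in P}.

Definition CG_adj (G : sgraph) (P : {set {set G}}) : rel (CG_vertex P) :=
  fun A B => coalition (val A) (val B).

Lemma CG_adj_sym (G : sgraph) (P : {set {set G}}) : symmetric (@CG_adj G P).
Proof. by move=> A B; apply: coalition_sym. Qed.

Lemma CG_adj_irrefl (G : sgraph) (P : {set {set G}}) : irreflexive (@CG_adj G P).
Proof. by move=> A; apply: coalition_irrefl. Qed.

Definition CG (G : sgraph) (P : {set {set G}}) : sgraph :=
  SGraph (@CG_adj_sym G P) (@CG_adj_irrefl G P).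

Definition Gamma1 (G : sgraph) : {set {set G}} := [set [set v] | v : G].

Definition SP_graph (G : sgraph) : bool := coalition_partition (Gamma1 G).

(* A nonempty sequence of graphs, finite (with its first term given apart) or
   infinite. *)
Inductive graph_seq :=
  | FinSeq of sgraph & seq sgraph
  | InfSeq of nat -> sgraph.

(* The term of index [i], counted from 0; [None] past the end. *)
Definition term (c : graph_seq) (i : nat) : option sgraph :=
  match c with
  | FinSeq G s => List.nth_error (G :: s) i
  | InfSeq f => Some (f i)
  end.

(* Graphs are taken up to isomorphism, the initial one included. *)
Definition SC_chain_from (G : sgraph) (c : graph_seq) : Prop :=
  (forall H, term c 0 = Some H -> giso H G) /\
  (forall i H K, term c i = Some H -> term c i.+1 = Some K ->
     SP_graph H /\ giso K (CG (Gamma1 H))).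

Definition is_SC_chain (G : sgraph) (c : graph_seq) : Prop :=
  SC_chain_from G c /\
  (forall c', SC_chain_from G c' -> forall i, term c' i -> term c i).

(* [None] stands for an infinite length. *)
Definition chain_length (c : graph_seq) : option nat :=
  if `[< forall i j H K, term c i = Some H -> term c j = Some K -> giso H K >]
  then Some 0
  else match c with
       | FinSeq _ s => Some (size s)
       | InfSeq _ => None
       end.

Lemma giso_refl G : giso G G.
Proof. by exists id; split=> //; exists id. Qed.

Lemma giso_sym G H : giso G H -> giso H G.
Proof.
case=> f [[g fK gK] fadj]; exists g; split; first by exists f.
by move=> x y; rewrite -fadj !gK.
Qed.

Lemma giso_trans G H K : giso G H -> giso H K -> giso G K.
Proof.
case=> f [bf fadj] [g [bg gadj]]; exists (g \o f); split; first exact: bij_comp.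
by move=> x y; rewrite /= gadj fadj.
Qed.

Lemma dominating_iso (G H : sgraph) (f : G -> H) (A : {set G}) :
  bijective f -> (forall x y, adj (f x) (f y) = adj x y) ->
  dominating (f @: A) = dominating A.
Proof.
move=> bf fadj; have fI := bij_inj bf; case: (bf) => g fK gK.
apply/forallP/forallP => h v; apply/implyP => vA.
  have /implyP/(_ _)/existsP[|w /andP[/imsetP[u uA ->]]] := h (f v).
    by rewrite mem_imset.
  by rewrite fadj => vu; apply/existsP; exists u; rewrite uA.
rewrite -(gK v) mem_imset // in vA.
have /implyP/(_ vA)/existsP[w /andP[wA gw]] := h (g v).
by apply/existsP; exists (f w); rewrite imset_f //= -(gK v) fadj.
Qed.

Lemma coalition_iso (G H : sgraph) (f : G -> H) (A B : {set G}) :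
  bijective f -> (forall x y, adj (f x) (f y) = adj x y) ->
  coalition (f @: A) (f @: B) = coalition A B.
Proof.
move=> bf fadj; rewrite /coalition -imsetU !(dominating_iso _ bf fadj).
by rewrite -!setI_eq0 -imsetI ?imset_eq0 //; move=> x y _ _; apply: bij_inj.
Qed.

Lemma imset_Gamma1 (G H : sgraph) (f : G -> H) (A : {set G}) :
  A \in Gamma1 G -> f @: A \in Gamma1 H.
Proof. by case/imsetP=> v _ ->; rewrite imset_set1 imset_f. Qed.

Lemma CG_Gamma1_iso (G H : sgraph) :
  giso G H -> giso (CG (Gamma1 G)) (CG (Gamma1 H)).
Proof.
case=> f [bf fadj]; case: (bf) => g fK gK.
pose F (A : CG (Gamma1 G)) : CG (Gamma1 H) :=
  Sub (f @: val A) (imset_Gamma1 f (valP A)).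
pose F' (A : CG (Gamma1 H)) : CG (Gamma1 G) :=
  Sub (g @: val A) (imset_Gamma1 g (valP A)).
exists F; split; last by move=> A B; apply: (coalition_iso _ _ bf fadj).
exists F' => A; apply: val_inj; rewrite /= -imset_comp.
  by rewrite (eq_imset _ fK) imset_id.
by rewrite (eq_imset _ gK) imset_id.
Qed.

Lemma partition_Gamma1 G : partition (Gamma1 G) [set: G].
Proof.
apply/and3P; split.
- rewrite eqEsubset subsetT /=; apply/subsetP => v _.
  by apply/bigcupP; exists [set v]; rewrite ?imset_f ?inE.
- apply/trivIsetP => _ _ /imsetP[u _ ->] /imsetP[v _ ->] neq.
  by rewrite disjoints1 inE; apply: contra neq => /eqP->.
- by apply/imsetP => -[v _ /setP/(_ v)]; rewrite !inE eqxx.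
Qed.

Lemma SP_graph_iso (G H : sgraph) : giso G H -> SP_graph G -> SP_graph H.
Proof.
case=> f [bf fadj] /andP[_ /forallP hG]; apply/andP; split.
  exact: partition_Gamma1.
case: (bf) => g fK gK; apply/forallP => B; apply/implyP => BH.
have defB : B = f @: (g @: B) by rewrite -imset_comp (eq_imset _ gK) imset_id.
move: (g @: B) (imset_Gamma1 g BH) defB => A AG defB; subst B.
have /implyP/(_ AG) := hG A; rewrite (dominating_iso _ bf fadj).
rewrite (card_imset _ (bij_inj bf)) => /orP[->//|/andP[nd /existsP[C]]].
case/and3P=> CG neC coC; rewrite (negPf nd) /=.
apply/existsP; exists (f @: C); rewrite imset_Gamma1 //=.
rewrite (coalition_iso _ _ bf fadj) coC andbT.
by apply: contra neC => /eqP/(imset_inj (bij_inj bf))->.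
Qed.

Lemma term_size G s i : term (FinSeq G s) i = (i <= size s) :> bool.
Proof.
rewrite /= -ltnS -[(size s).+1]/(size (G :: s)).
by elim: (G :: s) i => [|H t IH] [|i] //=; rewrite IH.
Qed.

Lemma term_leq c i j : i <= j -> term c j -> term c i.
Proof. by case: c => [G s|//] ij; rewrite !term_size; apply: leq_trans. Qed.

Definition CG1_iter (G : sgraph) (i : nat) : sgraph :=
  iter i (fun H => CG (Gamma1 H)) G.

Lemma SC_chain_from_iter G c : SC_chain_from G c ->
  forall i H, term c i = Some H ->
  giso H (CG1_iter G i) /\ forall j, j < i -> SP_graph (CG1_iter G j).
Proof.
case=> c0 cS; elim=> [|i IH] K cK; first by split=> //; apply: c0.
have := @term_leq c i i.+1 (leqnSn i); rewrite cK => /(_ isT).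
case cH: (term c i) => [H|//] _.
have [isoH SPj] := IH _ cH; have [SPH isoK] := cS _ _ _ cH cK.
split; first by apply: giso_trans isoK _; apply: CG_Gamma1_iso.
move=> j; rewrite ltnS leq_eqVlt => /orP[/eqP->|]; last exact: SPj.
exact: SP_graph_iso SPH.
Qed.

Lemma nth_error_iota (f : nat -> sgraph) m n i :
  List.nth_error [seq f j | j <- iota m n] i =
  if i < n then Some (f (m + i)) else None.
Proof.
elim: n m i => [|n IH] m [|i] //=; first by rewrite addn0.
by rewrite IH addSnnS.
Qed.

Lemma SC_chain_exists G : exists c, is_SC_chain G c.
Proof.
have [nSP|allSP] := pselect (exists i, ~~ SP_graph (CG1_iter G i)); last first.
  exists (InfSeq (CG1_iter G)); split=> //; split=> [H [<-]|i H K [<-] [<-]].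
    exact: giso_refl.
  split; last exact: giso_refl.
  by apply/negPn/negP => h; apply: allSP; exists i.
case: (ex_minnP nSP) => n nSPn n_min.
pose c := FinSeq G [seq CG1_iter G j | j <- iota 1 n].
have cE i : term c i = if i < n.+1 then Some (CG1_iter G i) else None.
  exact: (nth_error_iota (CG1_iter G) 0 n.+1).
exists c; split; first split=> [H [<-]|i H K]; first exact: giso_refl.
  rewrite !cE; case: ifP => // _ [<-]; case: ifP => // lt_in [<-].
  split; last exact: giso_refl.
  apply/negPn/negP => /n_min; rewrite leqNgt; move: lt_in; rewrite ltnS.
  by move=> ->.
move=> c' c'G i; rewrite cE ltnS; case: leqP => // lt_ni.
case c'i: (term c' i) => [H|//] _.
by have [_ /(_ _ lt_ni)] := SC_chain_from_iter c'G c'i; rewrite (negPf nSPn).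
Qed.

Lemma SC_chain_unique G c c' : is_SC_chain G c -> is_SC_chain G c' ->
  forall i, term c i = term c' i :> bool /\
    forall H K, term c i = Some H -> term c' i = Some K -> giso H K.
Proof.
move=> [cG cmax] [c'G c'max] i; split.
  by apply/idP/idP; [apply: c'max | apply: cmax].
move=> H K cH cK; have [isoH _] := SC_chain_from_iter cG cH.
have [isoK _] := SC_chain_from_iter c'G cK.
exact: giso_trans isoH (giso_sym isoK).
Qed.

Definition SC_chain (G : sgraph) : graph_seq := sval (cid (SC_chain_exists G)).

(* By [SC_chain_unique], independent of the chain chosen by [SC_chain]. *)
Definition L_SCC (G : sgraph) : option nat := chain_length (SC_chain G).

Section ConcreteGraphs.
Variables m n : nat.

Definition complete_adj : rel 'I_n := fun x y => x != y.
Lemma complete_sym : symmetric complete_adj.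
Proof. by move=> x y; rewrite /complete_adj eq_sym. Qed.
Lemma complete_irrefl : irreflexive complete_adj.
Proof. by move=> x; rewrite /complete_adj eqxx. Qed.
Definition complete : sgraph := SGraph complete_sym complete_irrefl.

Definition edgeless_adj : rel 'I_n := fun _ _ => false.
Lemma edgeless_sym : symmetric edgeless_adj. Proof. by []. Qed.
Lemma edgeless_irrefl : irreflexive edgeless_adj. Proof. by []. Qed.
Definition edgeless : sgraph := SGraph edgeless_sym edgeless_irrefl.

Definition path_adj : rel 'I_n := fun x y => (x.+1 == y) || (y.+1 == x).
Lemma path_sym : symmetric path_adj.
Proof. by move=> x y; rewrite /path_adj orbC. Qed.
Lemma path_irrefl : irreflexive path_adj.
Proof. by move=> x; rewrite /path_adj orbb gtn_eqF. Qed.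
Definition path_graph : sgraph := SGraph path_sym path_irrefl.

Definition bip_adj : rel ('I_m + 'I_n)%type := fun x y =>
  match x, y with
  | inl _, inr _ | inr _, inl _ => true
  | _, _ => false
  end.
Lemma bip_sym : symmetric bip_adj. Proof. by move=> [x|x] [y|y]. Qed.
Lemma bip_irrefl : irreflexive bip_adj. Proof. by case. Qed.
Definition complete_bipartite : sgraph := SGraph bip_sym bip_irrefl.

End ConcreteGraphs.

Section DisjointUnion.
Variables G H : sgraph.

Definition dunion_adj : rel (G + H)%type := fun x y =>
  match x, y with
  | inl u, inl v => adj u v
  | inr u, inr v => adj u v
  | _, _ => false
  end.
Lemma dunion_sym : symmetric dunion_adj.
Proof. by move=> [x|x] [y|y] //=; apply: adj_sym. Qed.
Lemma dunion_irrefl : irreflexive dunion_adj.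
Proof. by move=> [x|x]; apply: adj_irrefl. Qed.
Definition dunion : sgraph := SGraph dunion_sym dunion_irrefl.

End DisjointUnion.

Definition alternating (G H : sgraph) : graph_seq :=
  InfSeq (fun i => if odd i then H else G).

(* Main.v *)
Require Import Defs.
From mathcomp Require Import all_boot.
From mathcomp Require Import boolp.

(** If u is a leaf attached to the full vertex v and n > 2, then v is the only
    full vertex, so v is isolated in the coalition graph.  Two singletons
    other than {v} can dominate u only if one of them is {u}; as G is an
    SP-graph, every vertex outside {u, v} must then have {u} as a coalition
    partner.  Hence CG(G, Gamma_1) is K_1 together with a star centred at u. *)

Set Implicit Arguments.
Unset Strict Implicit.
Unset Printing Implicit Defensive.

(** * Coalitions between singletons, and coalition graphs of the singleton partition *)

Lemma dominating1 (G : sgraph) (x : G) : dominating [set x] = full_vertex x.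
Proof.
apply: eq_forallb => z; rewrite inE; congr (_ ==> _).
apply/existsP/idP => [[y]|xz]; first by rewrite inE adj_sym => /andP[/eqP->].
by exists x; rewrite inE eqxx adj_sym.
Qed.

Lemma coalition1E (G : sgraph) (x y : G) :
  coalition [set x] [set y] =
  [&& x != y, ~~ full_vertex x, ~~ full_vertex y
    & [forall z, [|| z == x, z == y, adj z x | adj z y]]].
Proof.
rewrite /coalition disjoints1 inE !dominating1; congr [&& _, _, _ & _].
apply: eq_forallb => z; rewrite !inE negb_or.
have [//|_] /= := eqVneq z x; have [//|_] /= := eqVneq z y.
apply/existsP/orP => [[w /andP[]]|[zx|zy]].
- by rewrite !inE => /orP[/eqP->|/eqP->] ->; [left|right].
- by exists x; rewrite !inE eqxx.
- by exists y; rewrite !inE eqxx orbT.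
Qed.

Lemma SP_graphP (G : sgraph) :
  reflect (forall x : G,
             full_vertex x \/ exists y : G, coalition [set x] [set y])
          (SP_graph G).
Proof.
rewrite /SP_graph /coalition_partition partition_Gamma1 /=.
apply: (iffP forall_inP) => [h x|h _ /imsetP[x _ ->]].
  have := h [set x] (imset_f _ isT).
  rewrite dominating1; case/orP=> [/andP[xf _]|]; first by left.
  case/andP=> _ /existsP[_ /and3P[/imsetP[y _ ->] _ xy]].
  by right; exists y.
rewrite dominating1 cards1 eqxx andbT; case: (h x) => [-> //|[y xy]].
case: (boolP (full_vertex x)) => //= nfx.
apply/existsP; exists [set y]; rewrite imset_f //= xy andbT.
by move: xy; rewrite coalition1E => /and4P[xy _ _ _]; rewrite (inj_eq set1_inj) eq_sym.
Qed.

(** The map sending [x] to the singleton of [f x] is injective, and [Gamma1 G] has at most [#|G|]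
    members, so it is a bijection. Coalition graphs are identified below by labelling the vertices
    of [G] with those of a known graph. *)
Lemma giso_CG_Gamma1 (G H : sgraph) (f : H -> G) :
  bijective f ->
  (forall x y, coalition [set f x] [set f y] = adj x y) ->
  giso H (CG (Gamma1 G)).
Proof.
move=> bf fadj.
pose F (x : H) : CG (Gamma1 G) := Sub [set f x] (imset_f _ isT).
exists F; split; last by move=> x y; rewrite -fadj.
have FI : injective F by move=> x y /(congr1 val)/set1_inj/(bij_inj bf).
apply: inj_card_bij FI _; rewrite card_sig (bij_eq_card bf).
by rewrite (@leq_trans #|Gamma1 G|) ?leq_imset_card // (eq_card (B := Gamma1 G)).
Qed.

(** * Recognising SC chains and their lengths *)

Lemma is_SC_chain_alternating (G H K : sgraph) :
  giso H G -> SP_graph H -> SP_graph K ->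
  giso K (CG (Gamma1 H)) -> giso H (CG (Gamma1 K)) ->
  is_SC_chain G (alternating H K).
Proof.
(* Maximality is immediate: an infinite sequence has a term at every index. *)
move=> HG SPH SPK KH HK; split=> //; split=> [_ [<-] //|i _ _ [<-] [<-]].
by rewrite /=; case: (odd i).
Qed.

(** [L_SCC] reads a chosen chain, which by uniqueness has the same terms up to isomorphism. It
    therefore never ends, and its first two terms are not isomorphic, so the convention of length 0
    does not apply. *)
Lemma L_SCC_alternating (G H K : sgraph) :
  is_SC_chain G (alternating H K) -> ~ giso H K -> L_SCC G = None.
Proof.
move=> altG nHK; rewrite /L_SCC /SC_chain; case: cid => c /= cG.
have termc i : term c i by have [->] := SC_chain_unique cG altG i.
rewrite /chain_length asboolF.
  (* The index [(size s).+1] is the first one past the end of a finite chain. *)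
  by case: c termc {cG} => // A s /(_ (size s).+1); rewrite term_size ltnn.
move=> all_iso; apply: nHK.
have [_ i0] := SC_chain_unique cG altG 0.
have [_ i1] := SC_chain_unique cG altG 1.
case c0: (term c 0) (termc 0) => [A|//] _; case c1: (term c 1) (termc 1) => [B|//] _.
apply: giso_trans (giso_sym (i0 _ _ c0 erefl)) _.
exact: giso_trans (all_iso _ _ _ _ c0 c1) (i1 _ _ c1 erefl).
Qed.

Lemma is_SC_chain_length1 (G K : sgraph) :
  L_SCC G = Some 1 -> giso K (CG (Gamma1 G)) ->
  is_SC_chain G (FinSeq G [:: K]).
Proof.
rewrite /L_SCC /SC_chain; case: cid => c /= [cG cmax].
(* Length 1 leaves only a two-term chain [A], [B]. Its maximality passes to every two-term chain
   from [G], and its first step shows that [G] is an SP-graph. *)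
rewrite /chain_length; case: ifP => // _; case: c cG cmax => // A [//|B []//].
move=> cG cmax _ KG; split; last first.
  by move=> c' c'G i /(cmax _ c'G); rewrite !term_size.
split=> [_ [<-]|[|[|i]] // _ _ [<-] [<-]]; first exact: giso_refl.
split=> //; have [A0 AS] := cG; have [SPA _] := AS 0 _ _ erefl erefl.
exact: SP_graph_iso (A0 _ erefl) SPA.
Qed.

(** * Leaves in a graph with a full vertex *)

Lemma min_degree1_leaf (G : sgraph) :
  1 < #|G| -> min_degree G = 1 -> exists u : G, degree u = 1.
Proof.
move=> G_gt1; rewrite /min_degree.
apply: (big_rec (fun m => m = 1 -> exists u : G, degree u = 1)).
  (* The neutral value [#|G|] of the minimum exceeds 1, so the value 1 is the degree of some
     vertex. *)
  by move=> G1; rewrite G1 in G_gt1.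
by move=> u m _ IH; rewrite /minn; case: ifP => // _ u1; exists u.
Qed.

Lemma full_vertex_adj (G : sgraph) (v x : G) :
  full_vertex v -> adj v x = (x != v).
Proof.
move=> /forallP/(_ x); have [->|_] := eqVneq x v; by rewrite ?adj_irrefl.
Qed.

Lemma leaf_of_full_vertex (G : sgraph) (u v : G) :
  2 < #|G| -> degree u = 1 -> full_vertex v ->
  u != v /\ forall x, adj u x = (x == v).
Proof.
move=> G_gt2 u1 vf; have uv : u != v.
  (* If [u] were full, all other vertices would be its neighbours, giving order at most 2. *)
  apply: contraTneq vf => <-; apply: contraL G_gt2 => uf.
  rewrite -leqNgt -cardsT -(setD1K (in_setT u)) cardsU1 !inE eqxx -u1 leq_add2l.
  by apply: subset_leq_card; apply/subsetP => x; rewrite !inE andbT full_vertex_adj.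
split=> // x; move/eqP/cards1P: u1 => [w Nu].
have Nx y : adj u y = (y == w) by have/setP/(_ y) := Nu; rewrite !inE.
by have := Nx v; rewrite adj_sym full_vertex_adj // uv Nx => /esym/eqP->.
Qed.

(** * The coalition graph when a leaf hangs at the full vertex *)

Section LeafAtFullVertex.
Variables (G : sgraph) (u v : G).
Hypothesis G_gt2 : 2 < #|G|.
Hypothesis SPG : SP_graph G.
Hypothesis full_v : full_vertex v.
Hypothesis uv : u != v.
Hypothesis adj_u : forall x, adj u x = (x == v).

(** A full vertex other than [u] is a neighbour of [u], hence [v]; if [u] itself were full, [G]
    would consist of [u] and [v] only. *)
Lemma full_vertex_unique x : full_vertex x = (x == v).
Proof.
apply/idP/eqP => [xf|-> //]; apply/eqP; have [xu|xu] := eqVneq x u; last first.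
  by rewrite -adj_u adj_sym (full_vertex_adj _ xf) eq_sym.
subst x; move: G_gt2; rewrite -cardsT (_ : setT = [set u; v]) ?cards2 ?uv //.
by apply/setP => x; rewrite !inE -adj_u (full_vertex_adj _ xf); case: eqP.
Qed.

Lemma coalition_leaf x y :
  coalition [set x] [set y] = [&& x != v, y != v & (x == u) != (y == u)].
Proof.
(* Necessity: domination is tested at [u], whose closed neighbourhood is [u], [v], and the full
   vertex [v] is in no coalition. *)
have coP a b : coalition [set a] [set b] ->
    [&& a != v, b != v & (a == u) != (b == u)].
  rewrite coalition1E !full_vertex_unique => /and4P[ab av bv /forallP/(_ u)].
  rewrite !adj_u (negPf av) (negPf bv) !orbF ![u == _]eq_sym /= => /orP[]/eqP e.
    by move: ab; rewrite e eqxx [u == b]eq_sym => /negPf->.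
  by move: ab; rewrite e eqxx => /negPf->.
(* Sufficiency: [a] is not full, so it has some partner, and [coP] forces this partner to be [u]. *)
have coU a : a != v -> a != u -> coalition [set a] [set u].
  move=> av au; have [|[b ab]] := SP_graphP _ SPG a.
    by rewrite full_vertex_unique (negPf av).
  have /and3P[_ _] := coP _ _ ab; rewrite (negPf au).
  by have [<-|] := eqVneq b u.
apply/idP/idP => [/coP //|/and3P[xv yv]].
have [->|xu] := eqVneq x u; have [->|yu] := eqVneq y u => // _.
  by rewrite coalition_sym coU.
exact: coU.
Qed.

Lemma giso_star_CG :
  giso (dunion (complete 1) (complete_bipartite 1 (#|G| - 2))) (CG (Gamma1 G)).
Proof.
have card_rest : #|G| - 2 = #|~: [set u; v]| by rewrite cardsCs setCK cards2 uv.
pose rest i : G := enum_val (cast_ord card_rest i).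
have restP i : (rest i != u) && (rest i != v).
  by have := enum_valP (cast_ord card_rest i); rewrite !inE negb_or.
(* The full vertex [v] is the isolated vertex, the leaf [u] becomes the centre of the star, and
   [rest] enumerates the other vertices as its leaves. *)
pose f (x : dunion (complete 1) (complete_bipartite 1 (#|G| - 2))) : G :=
  match x with inl _ => v | inr (inl _) => u | inr (inr i) => rest i end.
apply: (@giso_CG_Gamma1 _ _ f).
  apply: inj_card_bij; last by rewrite !card_sum !card_ord addnA subnKC // ltnW.
  case=> [i|[i|i]] [j|[j|j]] /= => [_|/eqP|/eqP|/eqP|_|/eqP|/eqP|/eqP|].
  - by rewrite (ord1 i) (ord1 j).
  - by rewrite eq_sym (negPf uv).
  - by rewrite eq_sym; case/andP: (restP j) => _ /negPf->.
  - by rewrite (negPf uv).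
  - by rewrite (ord1 i) (ord1 j).
  - by rewrite eq_sym; case/andP: (restP j) => /negPf->.
  - by case/andP: (restP i) => _ /negPf->.
  - by case/andP: (restP i) => /negPf->.
  - by move=> /enum_val_inj/cast_ord_inj->.
case=> [i|[i|i]] [j|[j|j]]; rewrite coalition_leaf /= ?eqxx ?uv //=.
- by rewrite (ord1 i) (ord1 j).
- by case/andP: (restP j) => /negPf-> ->.
- by rewrite andbF.
- by case/andP: (restP i) => /negPf-> ->.
- by case/andP: (restP i) => /negPf->; case/andP: (restP j) => /negPf->; rewrite !andbF.
Qed.

Lemma giso_P3 : #|G| = 3 -> giso (path_graph 3) G.
Proof.
move=> G3; have /card_gt0P[w] : 0 < #|~: [set u; v]|.
  by rewrite cardsCs setCK cards2 uv G3.
rewrite !inE negb_or => /andP[wu wv].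
(* The full vertex is the middle of the path; [u] and [w] are not adjacent because [v] is the only
   neighbour of [u]. *)
pose f (i : path_graph 3) : G := nth v [:: u; v; w] i.
exists f; split.
  apply: inj_card_bij; last by rewrite G3 card_ord.
  move=> i j /eqP; rewrite nth_uniq ?ltn_ord // => [/eqP/val_inj //|].
  by rewrite /= !inE negb_or uv ![_ == w]eq_sym wu wv.
have adj_v := full_vertex_adj _ full_v; have adjC := @adj_sym G.
by case=> [[|[|[|//]]] ?] [[|[|[|//]]] ?];
  rewrite /f /= ?adj_irrefl // ?adj_u ?adj_v ?[adj w _]adjC ?adj_u ?adj_v
          ?eqxx ?(negPf wu) ?(negPf wv) ?uv.
Qed.

End LeafAtFullVertex.

(** * The explicit graphs in the chains of orders 2 and 3 *)

Lemma giso_complete (G : sgraph) (n : nat) :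
  #|G| = n -> (forall x y : G, adj x y = (x != y)) -> giso G (complete n).
Proof.
move=> <- Gadj; exists enum_rank; split; first exact: enum_rank_bij.
by move=> x y; rewrite Gadj /= /complete_adj (inj_eq enum_rank_inj).
Qed.

Lemma complete_full n (x : complete n) : full_vertex x.
Proof. by apply/forallP => y; rewrite eq_sym implybb. Qed.

(** Every singleton of a complete graph already dominates, so there are no coalitions. *)
Lemma giso_CG_complete n : giso (edgeless n) (CG (Gamma1 (complete n))).
Proof.
apply: (@giso_CG_Gamma1 (complete n) (edgeless n) id); first by exists id.
by move=> x y; rewrite coalition1E complete_full !andbF.
Qed.

Lemma coalition_edgeless2 (x y : edgeless 2) :
  coalition [set x] [set y] = (x != y).
Proof.
have nf (z : edgeless 2) : full_vertex z = false.
  (* On two vertices [rev_ord] is the swap, so [rev_ord z] is the vertex that [z] misses. *)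
  by apply/forallP => /(_ (rev_ord z)); case: z => [[|[|//]] ?].
rewrite coalition1E !nf; apply: andb_idr => xy; apply/forallP => z.
by case: x y z xy => [[|[|//]] ?] [[|[|//]] ?] [[|[|//]] ?].
Qed.

Lemma SP_edgeless2 : SP_graph (edgeless 2).
Proof.
apply/SP_graphP => x; right; exists (rev_ord x).
by rewrite coalition_edgeless2; case: x => [[|[|//]] ?].
Qed.

Lemma giso_CG_edgeless2 : giso (complete 2) (CG (Gamma1 (edgeless 2))).
Proof.
by apply: (@giso_CG_Gamma1 (edgeless 2) (complete 2) id); [exists id | exact: coalition_edgeless2].
Qed.

Lemma not_giso_K2_edgeless2 : ~ giso (complete 2) (edgeless 2).
Proof. by case=> f [_ /(_ ord0 ord_max)]. Qed.

(** For order 3 the star has a single edge; this links [giso_star_CG] to the second graph of the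
    alternating chain. *)
Lemma giso_K1_star1 :
  giso (dunion (complete 1) (complete_bipartite 1 1))
       (dunion (complete 1) (complete 2)).
Proof.
pose f (x : dunion (complete 1) (complete_bipartite 1 1)) :
    dunion (complete 1) (complete 2) :=
  match x with
  | inl i => inl i | inr (inl _) => inr ord0 | inr (inr _) => inr ord_max
  end.
exists f; split; last by case=> [i|[i|i]] [j|[j|j]].
apply: inj_card_bij; last by rewrite !card_sum !card_ord.
by case=> [i|[i|i]] [j|[j|j]] //= _; rewrite (ord1 i) (ord1 j).
Qed.

(** A dominating set must meet both components, and since each component is complete, meeting both
    suffices. No vertex is full. *)
Lemma coalition_K1_K2 (x y : dunion (complete 1) (complete 2)) :
  coalition [set x] [set y] =
  match x, y with inl _, inr _ | inr _, inl _ => true | _, _ => false end.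
Proof.
have nf (z : dunion (complete 1) (complete 2)) : full_vertex z = false.
  by apply/forallP; case: z => [i /(_ (inr ord0))|i /(_ (inl ord0))].
rewrite coalition1E !nf /=; case: x y => [i|i] [j|j] /=.
- by rewrite (ord1 i) (ord1 j) eqxx.
- apply/forallP => -[k|k]; first by rewrite (ord1 i) (ord1 k) eqxx.
  by rewrite /= /complete_adj; case: (eqVneq k j) => [->|_]; rewrite ?eqxx ?orbT.
- apply/forallP => -[k|k]; last first.
    by rewrite /= /complete_adj; case: (eqVneq k i) => [->|_]; rewrite ?eqxx ?orbT.
  by rewrite (ord1 j) (ord1 k) eqxx orbT.
- by apply/andP => -[_ /forallP/(_ (inl ord0))].
Qed.

Lemma SP_K1_K2 : SP_graph (dunion (complete 1) (complete 2)).
Proof.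
apply/SP_graphP => -[i|i]; right; first by exists (inr ord0); rewrite coalition_K1_K2.
by exists (inl ord0); rewrite coalition_K1_K2.
Qed.

Lemma giso_CG_K1_K2 :
  giso (path_graph 3) (CG (Gamma1 (dunion (complete 1) (complete 2)))).
Proof.
(* The isolated vertex forms a coalition with both others, so it is placed in the middle. *)
pose f (i : path_graph 3) : dunion (complete 1) (complete 2) :=
  nth (inl ord0) [:: inr ord0; inl ord0; inr ord_max] i.
apply: (@giso_CG_Gamma1 _ _ f).
  apply: inj_card_bij; last by rewrite !card_sum !card_ord.
  by move=> i j /eqP; rewrite nth_uniq ?ltn_ord // => /eqP/val_inj.
by case=> [[|[|[|//]]] ?] [[|[|[|//]]] ?]; rewrite coalition_K1_K2.
Qed.

(** An isomorphism would pull the isolated vertex back to an isolated vertex of the path, which has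
    none. *)
Lemma not_giso_P3_K1_K2 :
  ~ giso (path_graph 3) (dunion (complete 1) (complete 2)).
Proof.
case=> f [[g fK gK] fadj]; pose i := g (inl ord0).
have [j] : exists j, adj i j.
  by case: i => [[|[|[|//]]] ?]; [exists (Ordinal (isT : 1 < 3)) | exists ord0
                               | exists (Ordinal (isT : 1 < 3))].
by rewrite -fadj gK; case: (f j) => // k; rewrite (ord1 k).
Qed.

Theorem theorem9 (G : sgraph) (n : nat) :
  #|G| = n -> SP_graph G -> min_degree G = 1 ->
  (exists v : G, full_vertex v) ->
  [/\ n = 2 ->
        [/\ giso G (complete 2), L_SCC G = None
          & is_SC_chain G (alternating (complete 2) (edgeless 2))],
      3 < n -> L_SCC G = Some 1 ->
        is_SC_chain G
          (FinSeq G [:: dunion (complete 1) (complete_bipartite 1 (n - 2))])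
    & n = 3 ->
        [/\ giso G (path_graph 3), L_SCC G = None
          & is_SC_chain G
              (alternating (path_graph 3)
                           (dunion (complete 1) (complete 2)))]].
Proof.
move=> <- SPG minG [v vf].
(* This leaf serves both the case n > 3 and the case n = 3. *)
have star : 2 < #|G| -> exists u, u != v /\ forall x, adj u x = (x == v).
  move=> G_gt2; have [u u1] := min_degree1_leaf (ltnW G_gt2) minG.
  by exists u; apply: leaf_of_full_vertex.
split=> [G2|G_gt3 len1|G3].
- have isoG : giso G (complete 2).
    apply: giso_complete => // x y; have [->|xy] := eqVneq x y; first exact: adj_irrefl.
    have [xv|xv] := eqVneq x v.
      by rewrite xv (full_vertex_adj _ vf) -xv eq_sym xy.
    have [yv|yv] := eqVneq y v.
      by rewrite adj_sym yv (full_vertex_adj _ vf) -yv xy.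
    (* Two distinct vertices other than [v] would make three vertices. *)
    have: 2 < #|G|; last by rewrite G2.
    by apply/card_gt2P; exists x, y, v; split; split=> //; rewrite eq_sym.
  have altG : is_SC_chain G (alternating (complete 2) (edgeless 2)).
    apply: (is_SC_chain_alternating (giso_sym isoG) (SP_graph_iso isoG SPG)).
    + exact: SP_edgeless2.
    + exact: giso_CG_complete.
    + exact: giso_CG_edgeless2.
  by split=> //; apply: L_SCC_alternating altG not_giso_K2_edgeless2.
- have [u [uv adj_u]] := star (ltnW G_gt3).
  by apply: is_SC_chain_length1 len1 (giso_star_CG _ _ _ uv adj_u); rewrite // ltnW.
- have G_gt2 : 2 < #|G| by rewrite G3.
  have [u [uv adj_u]] := star G_gt2.
  have isoP := giso_P3 vf uv adj_u G3.
  have altG : is_SC_chain G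
      (alternating (path_graph 3) (dunion (complete 1) (complete 2))).
    apply: (is_SC_chain_alternating isoP (SP_graph_iso (giso_sym isoP) SPG)).
    + exact: SP_K1_K2.
    (* The star description of the coalition graph of [G], taken at order 3, is carried over to the
       path along [isoP]. *)
    + have := giso_star_CG G_gt2 SPG vf uv adj_u; rewrite G3 => isoS.
      apply: giso_trans (giso_sym giso_K1_star1) (giso_trans isoS _).
      exact: CG_Gamma1_iso (giso_sym isoP).
    + exact: giso_CG_K1_K2.
  by split=> //; [apply: giso_sym | apply: L_SCC_alternating altG not_giso_P3_K1_K2].
Qed.
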